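(* The discrete logarithm function $\mathrm{dlog}(m,g,n)$ (for integer arguments $n\ge3$, $m\in\{2,\dots,n-1\}$ and $g\ge2$ such that $n$ and $m$ are coprime and $g$ is a primitive root modulo $n$) can be represented by the arithmetic term $$\mathrm{HW}(M(m,g,n))/\bigl(5+2n+2g(2g^{\varphi(n)}+1)\bigr)-(g^{\varphi(n)}+1)^4,$$ i.e. $\mathrm{dlog}(m,g,n)$ equals this expression for all such $m,g,n$, where $$\begin{aligned}M(m,g,n)={}&\mathcal C(1+m^2-2\varphi(n)+\varphi(n)^2,4)+\mathcal A(2mnx_4,4)+\mathcal A(n^2x_4^2,4)\\&+\mathcal A(2(1-\varphi(n))x_1,4)+\mathcal A(-2mg^{x_1+x_2+1},4)+\mathcal A(x_1^2,4)\\&+\mathcal A(2(1-\varphi(n))x_2,4)+\mathcal A(g^{2x_1+2x_2+2},4)+\mathcal A(x_2^2,4)\\&+\mathcal A(2(1-\varphi(n))x_3,4)+\mathcal A(-2nx_4g^{x_1+x_2+1},4)+\mathcal A(x_3^2,4)\\&+\mathcal A(2x_1x_2,4)+\mathcal A(2x_1x_3,4)+\mathcal A(2x_2x_3,4),\end{aligned}$$ with $\mathcal C$ and $\mathcal A$ formed with the parameters $t=g^{\varphi(n)}+1$ and $w=5+2n+2g(2g^{\varphi(n)}+1)$.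
   Context: $\varphi$ is Euler's totient function, which itself is representable by an arithmetic term for $n\ge2$. For coprime integers $n\ge2$ and $g\in\{1,\dots,n-1\}$, $g$ is a primitive root modulo $n$ if its multiplicative order modulo $n$ (the least positive $r$ with $g^r\equiv1\pmod n$) equals $\varphi(n)$. In that case, for $m\in\{1,\dots,n-1\}$ coprime with $n$, $\mathrm{dlog}(m,g,n)$ is the unique $d\in\{1,\dots,\varphi(n)\}$ with $g^d\equiv m\pmod n$. $\mathrm{HW}(N)$ is the Hamming weight of $N$ (number of ones in its binary representation). $G_r(q,s)=\sum_{j=0}^{s}j^rq^j$ with $0^0=1$; for each fixed $r$ this has a closed form. Given parameters $t>1$, $w$ (depending on the arguments) and $k\ge1$: $$\mathcal C(\varepsilon,k)=(2^w-\varepsilon+1)\,\frac{2^{2wt^k}-1}{2^w+1},$$ and for a monomial $\mu=\alpha\, b_1^{\beta_1x_1}\cdots b_k^{\beta_kx_k}x_1^{\gamma_1}\cdots x_k^{\gamma_k}$ in the formal variables $x_1,\dots,x_k$ (with $\alpha$ an integer possibly negative, and absent exponential factors meaning $\beta_i=0$, absent powers meaning $\gamma_i=0$; e.g. $-2mg^{x_1+x_2+1}$ has $\alpha=-2mg$, $b_1=b_2=g$, $\beta_1=\beta_2=1$), $$\mathcal A(\mu,k)=-(2^w-1)\,\alpha\prod_{i=1}^kG_{\gamma_i}\!\left(2^{2wt^{i-1}}b_i^{\beta_i},\,t-1\right).$$ An arithmetic term is an expression built from natural-number constants and the variables by the operations $x+y$, $\max(x-y,0)$, $\lfloor x/y\rfloor$,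 $x^y$ (with $0^0=1$, $\lfloor x/0\rfloor=0$). Products, $\mathrm{HW}$ and $G_r$ (fixed $r$) are expressible by arithmetic terms and are used as abbreviations; formulas are written with ordinary subtraction and exact division for readability. *)

(* Defs.v *)
From mathcomp Require Import all_boot all_order all_algebra.

Set Implicit Arguments.
Unset Strict Implicit.
Unset Printing Implicit Defensive.

Import GRing.Theory Num.Theory.

Definition is_mult_order (n g r : nat) : Prop :=
  [/\ 0 < r, g ^ r = 1 %[mod n]
    & forall s : nat, 0 < s -> g ^ s = 1 %[mod n] -> r <= s].

Definition is_primitive_root (n g : nat) : Prop :=
  [/\ 2 <= n, 1 <= g <= n.-1, coprime n g & is_mult_order n g (totient n)].

(* The value 0 is a default, returned when no exponent in {1, ..., totient n}
   works; it is never a discrete logarithm. *)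
Definition dlog (m g n : nat) : nat :=
  if [pick d : 'I_(totient n).+1 | (0 < d) && (g ^ d == m %[mod n])] is Some d
  then nat_of_ord d else 0.

(* Since N < 2 ^ N, all the binary digits of N have index i < N. *)
Definition HW (N : nat) : nat := \sum_(i < N) odd (N %/ 2 ^ i).

Local Open Scope ring_scope.

(* Computations take place in rat, so that subtraction and division are the
   exact ones, without truncation. *)

Definition Gsum (r : nat) (q : rat) (s : nat) : rat :=
  \sum_(j < s.+1) j%:R ^+ r * q ^+ j.

(* The formal monomial
     alpha * \prod_(i < k) b_i ^ (beta_i * x_i) * \prod_(i < k) x_i ^ gamma_i,
   with variables indexed from 0. *)
Record monomial (k : nat) := Monomial {
  mcoef : int;            (* alpha *)
  mbase : k.-tuple nat;   (* b     *)
  mexpo : k.-tuple nat;   (* beta  *)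
  mpow  : k.-tuple nat    (* gamma *)
}.

Definition Cterm (t w : nat) (eps : int) (k : nat) : rat :=
  (2 ^+ w - eps%:~R + 1) * ((2 ^+ (2 * w * t ^ k) - 1) / (2 ^+ w + 1)).

(* Variables are indexed from 0, so t ^ (i - 1) becomes t ^ i. *)
Definition Aterm (t w k : nat) (mu : monomial k) : rat :=
  - (2 ^+ w - 1) * (mcoef mu)%:~R *
  \prod_(i < k)
    Gsum (tnth (mpow mu) i)
      (2 ^+ (2 * w * t ^ i) * (tnth (mbase mu) i)%:R ^+ tnth (mexpo mu) i)
      t.-1.

Definition dlog_t (g n : nat) : nat := (g ^ totient n + 1)%N.

Definition dlog_w (g n : nat) : nat :=
  (5 + 2 * n + 2 * g * (2 * g ^ totient n + 1))%N.

Definition dlog_M (m g n : nat) : rat :=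
  let phi : int := (totient n)%:Z in
  let m' : int := m%:Z in
  let g' : int := g%:Z in
  let n' : int := n%:Z in
  let C := Cterm (dlog_t g n) (dlog_w g n) in
  (* the only exponential base is g; it is irrelevant where beta_i = 0 *)
  let A (alpha : int) (beta gamma : 4.-tuple nat) :=
    Aterm (dlog_t g n) (dlog_w g n)
      (Monomial alpha [tuple g; g; g; g] beta gamma) in
  let e0 : 4.-tuple nat := [tuple 0; 0; 0; 0]%N in
  let e12 : 4.-tuple nat := [tuple 1; 1; 0; 0]%N in
  C (1 + m' ^+ 2 - 2 * phi + phi ^+ 2) 4
  (* 2 m n x4 *)
  + A (2 * m' * n') e0 [tuple 0; 0; 0; 1]%N
  (* n^2 x4^2 *)
  + A (n' ^+ 2) e0 [tuple 0; 0; 0; 2]%N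
  (* 2 (1 - phi) x1 *)
  + A (2 * (1 - phi)) e0 [tuple 1; 0; 0; 0]%N
  (* - 2 m g^(x1 + x2 + 1) *)
  + A (- 2 * m' * g') e12 e0
  (* x1^2 *)
  + A 1 e0 [tuple 2; 0; 0; 0]%N
  (* 2 (1 - phi) x2 *)
  + A (2 * (1 - phi)) e0 [tuple 0; 1; 0; 0]%N
  (* g^(2 x1 + 2 x2 + 2) *)
  + A (g' ^+ 2) [tuple 2; 2; 0; 0]%N e0
  (* x2^2 *)
  + A 1 e0 [tuple 0; 2; 0; 0]%N
  (* 2 (1 - phi) x3 *)
  + A (2 * (1 - phi)) e0 [tuple 0; 0; 1; 0]%N
  (* - 2 n x4 g^(x1 + x2 + 1) *)
  + A (- 2 * n' * g') e12 [tuple 0; 0; 0; 1]%N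
  (* x3^2 *)
  + A 1 e0 [tuple 0; 0; 2; 0]%N
  (* 2 x1 x2 *)
  + A 2 e0 [tuple 1; 1; 0; 0]%N
  (* 2 x1 x3 *)
  + A 2 e0 [tuple 1; 0; 1; 0]%N
  (* 2 x2 x3 *)
  + A 2 e0 [tuple 0; 1; 1; 0]%N.

(* Main.v *)
Require Import Defs.
From mathcomp Require Import all_boot all_order all_algebra.
From mathcomp Require Import zify ring.

(** The formula counts lattice points with a Hamming weight. Put
    G = g ^ totient n, t = G + 1, and for x in the box {0, ..., G}^4 let
<<
  f x = (g ^ (x1 + x2 + 1) - m - n x4) ^ 2
        + (x1 + x2 + x3 + 1 - totient n) ^ 2.
>>
    At a zero of f the number e = x1 + x2 + 1 lies between 1 and totient n and
    satisfies g ^ e = m modulo n, so e is the discrete logarithm d; then x3 and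
    x4 are determined, and the only freedom left is the choice of x1 below d.
    Hence f has exactly d zeros in the box ([card_defect0]).

    The monomials of f are those of the definition of M. Its constant term
    gives the term C, a geometric sum over all positions below t ^ 4; any other
    monomial gives a product of four sums, which expands into a sum over the
    box. When x is identified with the number whose base t digits are its
    coordinates, M becomes ([dlog_M_box])
<<
  \sum_x 2 ^ (2 w x) * (2 ^ w - 1) * (2 ^ w + 1 - f x).
>>
    The parameter w is large enough for f <= 2 ^ w ([defect_leq]), so this is
    the concatenation of t ^ 4 binary blocks of 2 w digits. A block has weight
    2 w if f x = 0, and w otherwise ([HW_block]). The total weight is therefore
    w (t ^ 4 + d) ([HW_box]), from which division by w and subtraction of
    t ^ 4 recover d. *)

Set Implicit Arguments.
Unset Strict Implicit.
Unset Printing Implicit Defensive.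

Import GRing.Theory Num.Theory.

(** * Hamming weight *)

Lemma HW_widen (K N : nat) : N <= K -> HW N = \sum_(i < K) odd (N %/ 2 ^ i).
Proof.
move=> leNK; rewrite -(subnKC leNK) big_split_ord /= [X in _ + X]big1 ?addn0 //.
move=> i _; rewrite divn_small //.
by rewrite (leq_ltn_trans (leq_addr i N)) // ltn_expl.
Qed.

Lemma HW0 : HW 0 = 0.
Proof. by rewrite /HW big_ord0. Qed.

(** Peeling off the lowest binary digit: the recursion behind the inductions
    on the number of digits below. *)
Lemma HW_bit (b : bool) (N : nat) : HW (b + N.*2) = b + HW N.
Proof.
rewrite (@HW_widen (b + N.*2).+1) // big_ord_recl expn0 divn1.
rewrite oddD odd_double addbF oddb (@HW_widen (b + N.*2) N); last by lia.
congr (_ + _); apply: eq_bigr => i _.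
by rewrite expnS divnMA divn2 -[b + _]/(b + N.*2) half_bit_double.
Qed.

Lemma HW_split (k lo hi : nat) :
  lo < 2 ^ k -> HW (lo + 2 ^ k * hi) = HW lo + HW hi.
Proof.
elim: k lo => [|k IHk] lo.
  by rewrite expn0 ltnS leqn0 mul1n => /eqP->; rewrite HW0.
rewrite expnS => lt_lo; rewrite -[lo]odd_double_half.
have ->: odd lo + lo./2.*2 + 2 * 2 ^ k * hi
         = odd lo + (lo./2 + 2 ^ k * hi).*2.
  by rewrite doubleD addnA -!mul2n !mulnA.
rewrite !HW_bit IHk ?addnA //; lia.
Qed.

(** Subtraction from the all-ones word flips each of the [w] digits. *)
Lemma HW_compl (w Y : nat) :
  Y < 2 ^ w -> HW Y + HW (2 ^ w - 1 - Y) = w.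
Proof.
elim: w Y => [|w IHw] Y.
  by rewrite expn0 ltnS leqn0 => /eqP->; rewrite HW0.
rewrite expnS => ltY; have ltY2: Y./2 < 2 ^ w by lia.
have ->: 2 * 2 ^ w - 1 - Y = ~~ odd Y + (2 ^ w - 1 - Y./2).*2 by lia.
by rewrite -[in HW Y](odd_double_half Y) !HW_bit addnACA IHw //; case: odd.
Qed.

Lemma HW_ones (w : nat) : HW (2 ^ w - 1) = w.
Proof. by rewrite -[RHS](@HW_compl w 0) ?expn_gt0 // HW0 subn0. Qed.

(** This is how a test for zero becomes a weight. For [v = 0] the product is
    [2 ^ (2 * w) - 1], with [2 * w] ones. For [v = u + 1] it is
    [u + 2 ^ w * (2 ^ w - 1 - u)], whose two halves are complementary words, so
    that the weight is [w] independently of [u]. *)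
Lemma HW_block (w v : nat) : v <= 2 ^ w ->
  HW ((2 ^ w - 1) * (2 ^ w + 1 - v)) = w + (v == 0) * w.
Proof.
move=> le_v; have pos: 0 < 2 ^ w by rewrite expn_gt0.
case: v le_v => [|v] le_v /=.
  have ->: (2 ^ w - 1) * (2 ^ w + 1 - 0) = 2 ^ w - 1 + 2 ^ w * (2 ^ w - 1) by nia.
  by rewrite HW_split ?HW_ones ?mul1n //; lia.
have ->: (2 ^ w - 1) * (2 ^ w + 1 - v.+1) = v + 2 ^ w * (2 ^ w - 1 - v) by nia.
by rewrite HW_split // HW_compl // mul0n addn0.
Qed.

Lemma concat_lt (K L : nat) (B : 'I_L -> nat) :
  (forall a, B a < 2 ^ K) -> \sum_(a < L) 2 ^ (K * a) * B a < 2 ^ (K * L).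
Proof.
elim: L B => [|L IHL] B ltB; first by rewrite big_ord0 muln0.
rewrite big_ord_recr /= mulnS expnD.
have := IHL _ (fun a => ltB (widen_ord (leqnSn L) a)).
have := leq_mul (leqnn (2 ^ (K * L))) (ltB ord_max); rewrite mulnS.
by set S := \sum_(_ < _) _; rewrite [2 ^ K * _]mulnC; lia.
Qed.

(** The blocks do not overlap, so no carry occurs. *)
Lemma HW_concat (K L : nat) (B : 'I_L -> nat) :
  (forall a, B a < 2 ^ K) ->
  HW (\sum_(a < L) 2 ^ (K * a) * B a) = \sum_(a < L) HW (B a).
Proof.
elim: L B => [|L IHL] B ltB; first by rewrite !big_ord0 HW0.
have ltB' a : B (widen_ord (leqnSn L) a) < 2 ^ K by exact: ltB.
by rewrite !big_ord_recr /= HW_split ?(IHL _ ltB') //; exact: (concat_lt ltB').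
Qed.

(** * Numbering the points of a box *)

Definition undigits (t k : nat) (x : 'I_k -> 'I_t) : nat :=
  \sum_(i < k) x i * t ^ i.

Lemma undigits_recl (t k : nat) (x : 'I_k.+1 -> 'I_t) :
  undigits x = undigits (fun i => x (lift ord0 i)) * t + x ord0.
Proof.
rewrite /undigits big_ord_recl muln1 addnC big_distrl /=.
by congr (_ + _); apply: eq_bigr => i _; rewrite expnSr mulnA.
Qed.

Lemma undigits_lt (t k : nat) (x : 'I_k -> 'I_t) : undigits x < t ^ k.
Proof.
elim: k x => [|k IHk] x; first by rewrite /undigits big_ord0.
rewrite undigits_recl expnSr.
apply: leq_trans (leq_mul (IHk (fun i => x (lift ord0 i))) (leqnn t)).
by rewrite mulSn addnC ltn_add2r.
Qed.

Lemma undigits_inj (t k : nat) (x y : 'I_k -> 'I_t) :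
  undigits x = undigits y -> x =1 y.
Proof.
elim: k x y => [|k IHk] x y; first by move=> _ [].
rewrite !undigits_recl => eqxy i.
have t_gt0: 0 < t by rewrite (leq_ltn_trans _ (ltn_ord (x ord0))).
have eq0: x ord0 = y ord0.
  apply: val_inj; have /(congr1 (modn^~ t)) := eqxy.
  by rewrite /= !modnMDl !modn_small.
case: (unliftP ord0 i) => [j|] -> //.
apply: (IHk (fun i => x (lift ord0 i)) (fun i => y (lift ord0 i))).
move: eqxy; rewrite eq0 => /addIn /eqP.
by rewrite eqn_pmul2r // => /eqP.
Qed.

(** Injectivity and equality of cardinals make [undigits] a bijection from the
    box onto the positions below [t ^ k], so that sums over the two can be
    exchanged. *)
Lemma digitsP (t k : nat) :
  exists2 h : 'I_(t ^ k) -> {ffun 'I_k -> 'I_t},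
    bijective h & forall a, undigits (h a) = a.
Proof.
pose u (x : {ffun 'I_k -> 'I_t}) := Ordinal (undigits_lt x).
have [h uK hK]: bijective u.
  apply: inj_card_bij; last by rewrite card_ord card_ffun !card_ord.
  by move=> x y /(congr1 val) /= /undigits_inj /ffunP.
exists h; first by exists u.
by move=> a; rewrite -[in RHS](hK a).
Qed.

(** Each of the [t ^ k] points contributes a weight of [w], and each zero of [F]
    contributes a further [w]. *)
Lemma HW_box (t k w : nat) (F : {ffun 'I_k -> 'I_t} -> nat) :
  (forall x, F x <= 2 ^ w) ->
  HW (\sum_(x : {ffun 'I_k -> 'I_t})
        2 ^ (2 * w * undigits x) * ((2 ^ w - 1) * (2 ^ w + 1 - F x)))
  = w * (t ^ k + #|[set x | F x == 0%N]|).
Proof.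
move=> leF; have [h bij_h hK] := digitsP t k.
have on_h := onW_bij predT bij_h.
transitivity (\sum_x HW ((2 ^ w - 1) * (2 ^ w + 1 - F x))).
  rewrite (reindex h on_h) [RHS](reindex h on_h) -(@HW_concat (2 * w)).
    by congr HW; apply: eq_bigr => a _; rewrite hK.
  move=> a; have pos: 0 < 2 ^ w by rewrite expn_gt0.
  by rewrite mul2n -addnn expnD; nia.
under eq_bigr do rewrite HW_block //.
rewrite big_split /= sum_nat_const card_ffun !card_ord -big_distrl /=.
rewrite -sum1dep_card mulnDr mulnC [X in _ + X]mulnC.
by congr (_ + _ * _); rewrite [RHS]big_mkcond; apply: eq_bigr => x _; case: eqP.
Qed.

(** * The terms C and A as sums over the box *)

Local Open Scope ring_scope.

Lemma sum_expr_box (R : comNzRingType) (q : R) (t k : nat) :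
  \sum_(x : {ffun 'I_k -> 'I_t}) q ^+ undigits x = \sum_(a < t ^ k) q ^+ a.
Proof.
have [h bij_h hK] := digitsP t k.
by rewrite (reindex h (onW_bij _ bij_h)); apply: eq_bigr => a _; rewrite hK.
Qed.

(** In [Cterm] the denominator [2 ^ w + 1] cancels against the denominator
    [2 ^ (2 * w) - 1 = (2 ^ w - 1) * (2 ^ w + 1)] of the geometric sum, which
    leaves the factor [2 ^ w - 1]. *)
Lemma Cterm_box (t w : nat) (eps : int) (k : nat) :
  Cterm t w eps k =
  \sum_(x : {ffun 'I_k -> 'I_t})
    2 ^+ (2 * w * undigits x) * ((2 ^+ w - 1) * (2 ^+ w + 1 - eps%:~R)).
Proof.
have pos: 2 ^+ w + 1 != 0 :> rat by rewrite lt0r_neq0 // addr_gt0 // exprn_gt0.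
rewrite -big_distrl /=; under eq_bigr do rewrite exprM.
rewrite sum_expr_box /Cterm exprM subrX1 mulnC exprM.
by set S := \sum_(_ < _) _; field.
Qed.

Definition mvalue (t k : nat) (mu : monomial k)
    (x : {ffun 'I_k -> 'I_t}) : rat :=
  (mcoef mu)%:~R *
  \prod_(i < k) ((tnth (mbase mu) i)%:R ^+ (tnth (mexpo mu) i * x i)
                 * (x i)%:R ^+ tnth (mpow mu) i).

(** Distributing the product of the [k] sums gives one summand for each point of
    the box; the powers [2 ^ (2 * w * t ^ i * x i)] multiply to
    [2 ^ (2 * w * undigits x)]. *)
Lemma Aterm_box (t w k : nat) (mu : monomial k) : (0 < t)%N ->
  Aterm t w mu =
  - \sum_(x : {ffun 'I_k -> 'I_t})
      2 ^+ (2 * w * undigits x) * ((2 ^+ w - 1) * mvalue mu x).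
Proof.
move=> t_gt0; rewrite /Aterm /Gsum prednK // bigA_distr_bigA /=.
rewrite !mulNr big_distrr /=; congr (- _); apply: eq_bigr => x _.
rewrite /mvalue /undigits big_distrr /= expr_sum [RHS]mulrCA -[LHS]mulrA.
congr (_ * _); rewrite [RHS]mulrCA; congr (_ * _).
rewrite -big_split /=; apply: eq_bigr => i _.
rewrite exprMn -!exprM mulrC -mulrA; congr (_ ^+ _ * _).
by rewrite -mulnA [(t ^ i * _)%N]mulnC.
Qed.

Local Close Scope ring_scope.

(** * The discrete logarithm as a number of zeros *)

(** Cancelling the common power of [g], which is a unit modulo [n], turns two
    equal powers into an exponent [j - i < r] that sends [g] to 1; minimality of
    the order [r] forces it to be 0. *)
Lemma expn_mod_inj (n g r i j : nat) :
  0 < g -> coprime n g -> is_mult_order n g r ->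
  0 < i <= r -> 0 < j <= r -> g ^ i = g ^ j %[mod n] -> i = j.
Proof.
move=> g_gt0 co_ng [_ _ min_r].
wlog le_ij: i j / i <= j.
  move=> wlog_le hi hj eq_ij.
  by case: (leqP i j) => [|/ltnW] le; [|symmetry]; apply: wlog_le.
move=> /andP[i_gt0 _] /andP[_ le_jr] /esym /eqP; rewrite eqn_mod_dvd ?leq_pexp2l //.
rewrite -{1}(subnKC le_ij) expnD -{2}(muln1 (g ^ i)) -mulnBr Gauss_dvdr; last first.
  by rewrite coprimeXr.
rewrite -eqn_mod_dvd ?expn_gt0 ?g_gt0 // => /eqP eq1.
case: (posnP (j - i)) => [|ji_gt0]; first by lia.
by have := min_r _ ji_gt0 eq1; lia.
Qed.

Lemma dlog_eq (m g n e : nat) : is_primitive_root n g ->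
  0 < e <= totient n -> g ^ e = m %[mod n] -> dlog m g n = e.
Proof.
case=> _ /andP[g_gt0 _] co_ng ord_g e_bnd eq_e; rewrite /dlog.
case: pickP => [d /andP[d_gt0 /eqP eq_d] | none].
  apply: (expn_mod_inj g_gt0 co_ng ord_g) => //; last by rewrite eq_d.
  by rewrite d_gt0 -ltnS ltn_ord.
case/andP: e_bnd => e_gt0; rewrite -ltnS => lt_e.
by have := none (Ordinal lt_e); rewrite /= e_gt0 eq_e eqxx.
Qed.

Lemma dlogP (m g n : nat) : 0 < dlog m g n ->
  dlog m g n <= totient n /\ g ^ dlog m g n = m %[mod n].
Proof.
rewrite /dlog; case: pickP => // d /andP[_ /eqP eq_d] _.
by rewrite -ltnS ltn_ord.
Qed.

Definition defect (m g n x1 x2 x3 x4 : nat) : nat :=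
  `|g ^ (x1 + x2 + 1) - (m + n * x4)| ^ 2
  + `|x1 + x2 + x3 + 1 - totient n| ^ 2.

(** Coordinate number [i] of the box, counted from 0, is the variable
    [x_(i + 1)]. *)
Definition box_defect (m g n t : nat) (x : {ffun 'I_4 -> 'I_t}) : nat :=
  defect m g n (x (@Ordinal 4 0 isT)) (x (@Ordinal 4 1 isT))
               (x (@Ordinal 4 2 isT)) (x (@Ordinal 4 3 isT)).

Lemma defect_eq0 (m g n x1 x2 x3 x4 : nat) :
  (defect m g n x1 x2 x3 x4 == 0) =
  (g ^ (x1 + x2 + 1) == m + n * x4) && (x1 + x2 + x3 + 1 == totient n).
Proof. by rewrite /defect addn_eq0 !expn_eq0 !distn_eq0 !andbT. Qed.

(** The zeros are the points [(j, d - 1 - j, totient n - d, (g ^ d - m) / n)] with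
    [j < d = dlog m g n], and they lie in the box because
    [totient n < g ^ totient n] and [g ^ d <= g ^ totient n]. The argument
    covers the default value [d = 0] of [dlog]: there is then no zero. *)
Lemma card_defect0 (m g n t : nat) :
  2 <= g -> m < n -> is_primitive_root n g -> g ^ totient n < t ->
  #|[set x : {ffun 'I_4 -> 'I_t} | box_defect m g n x == 0]| = dlog m g n.
Proof.
move=> g_ge2 lt_mn prim_g; case: t => // T; rewrite ltnS => leT.
have n_gt0: 0 < n by lia.
have le_phi: totient n < g ^ totient n by rewrite ltn_expl.
set d := dlog m g n.
pose sol (j : 'I_d) : {ffun 'I_4 -> 'I_T.+1} :=
  [ffun i : 'I_4 =>
     inord (nth 0 [:: val j; d - 1 - j; totient n - d; (g ^ d - m) %/ n] i)].
have sol_bnd (j : 'I_d) :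
    [/\ j <= T, d - 1 - j <= T, totient n - d <= T & (g ^ d - m) %/ n <= T].
  have [|le_d _] := @dlogP m g n; first by apply: leq_trans (ltn_ord j).
  have le_gd: g ^ d <= T by apply: leq_trans leT; rewrite leq_pexp2l //; lia.
  have := leq_div (g ^ d - m) n; have := ltn_ord j; rewrite -/d in le_d *.
  by split; lia.
have sol_inj : injective sol.
  move=> j j' /ffunP /(_ (@Ordinal 4 0 isT)); rewrite !ffunE /= => /(congr1 val) /=.
  have [b _ _ _] := sol_bnd j; have [b' _ _ _] := sol_bnd j'.
  by rewrite !inordK // => eqj; exact: val_inj.
rewrite -[RHS]card_ord -(card_imset _ sol_inj); apply: eq_card => x.
rewrite inE /box_defect defect_eq0; apply/andP/imsetP => [[/eqP eq_g /eqP eq_phi]|].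
  move: eq_g eq_phi.
  set x1 := nat_of_ord (x _); set x2 := nat_of_ord (x _).
  set x4 := nat_of_ord (x _); set x3 := nat_of_ord (x _) => eq_g eq_phi.
  have eq_d: d = x1 + x2 + 1.
    apply: dlog_eq => //; first by lia.
    by rewrite eq_g mulnC addnC modnMDl.
  have lt_x1: x1 < d by lia.
  have eq4: (g ^ d - m) %/ n = x4 by rewrite eq_d eq_g addKn mulKn.
  exists (Ordinal lt_x1) => //; apply/ffunP => i; rewrite ffunE eq4.
  (* The other coordinates are forced by the two equations of the zero. *)
  suff ->: nth 0 [:: x1; d - 1 - x1; totient n - d; x4] i = x i.
    by rewrite inord_val.
  case: i => [[|[|[|[|i]]]] lt_i] //=;
    by rewrite (bool_irrelevance lt_i isT) -/x1 -/x2 -/x3 -/x4; lia.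
case=> j _ ->; have [b1 b2 b3 b4] := sol_bnd j; rewrite !ffunE /= !inordK //.
have [|le_d eq_gd] := @dlogP m g n; first by apply: leq_trans (ltn_ord j).
rewrite -/d in le_d eq_gd; have lt_jd := ltn_ord j.
have ->: j + (d - 1 - j) + 1 = d by lia.
split; last by apply/eqP; lia.
(* As m < n is the remainder of g ^ d, the difference g ^ d - m is exact. *)
have eq_gd' : g ^ d = g ^ d %/ n * n + m.
  by rewrite [LHS](divn_eq _ n) eq_gd (modn_small lt_mn).
by rewrite [in X in _ == X]eq_gd' addnK mulnK // addnC mulnC -eq_gd'.
Qed.

(** With [G = g ^ totient n] and [P = g ^ (2 * G + 1)], every quantity compared in
    [defect] is at most [Q = 2 ^ n * P]: the factor [2 ^ n] absorbs [n], and [P]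
    absorbs both [G + 1] and [3 * G + 1]. Since [g <= 2 ^ g], [Q <= 2 ^ E] for
    [E = n + g * (2 * G + 1)], and [2 * Q ^ 2 <= 2 ^ (2 * E + 1)], where
    [2 * E + 5] is exactly [dlog_w g n]. *)
Lemma defect_leq (m g n x1 x2 x3 x4 : nat) :
  2 <= g -> m <= n -> x1 <= g ^ totient n -> x2 <= g ^ totient n ->
  x3 <= g ^ totient n -> x4 <= g ^ totient n ->
  defect m g n x1 x2 x3 x4 <= 2 ^ dlog_w g n.
Proof.
move=> g_ge2 le_mn; rewrite /defect /dlog_w; set G := g ^ totient n.
move=> le1 le2 le3 le4; set P := g ^ (2 * G + 1).
have leP: 3 * G + 1 <= P.
  have h4: 3 * G + 1 <= 4 ^ G.
    by elim: (G) => // k IH; rewrite expnS; lia.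
  apply: (leq_trans h4); rewrite -[4]/(2 ^ 2) -expnM /P.
  by apply: (@leq_trans (2 ^ (2 * G + 1))); rewrite ?leq_pexp2l ?leq_exp2r; lia.
have le_nP: 1 + G <= P by lia.
have le_phi: totient n <= G by rewrite /G ltnW // ltn_expl.
set Q := 2 ^ n * P.
have le_PQ: P <= Q by rewrite /Q leq_pmull // expn_gt0.
have le_a: g ^ (x1 + x2 + 1) <= Q.
  by apply: leq_trans le_PQ; rewrite /P leq_pexp2l; lia.
have le_b: m + n * x4 <= Q.
  apply: (@leq_trans (n * (1 + G))); first by nia.
  by rewrite /Q leq_mul // ltnW // ltn_expl.
have le_Q: Q <= 2 ^ (n + g * (2 * G + 1)).
  rewrite /Q expnD leq_mul2l expnM leq_exp2r ?addn1 //.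
  by rewrite (ltnW (ltn_expl _ _)) ?orbT.
apply: (@leq_trans (2 * (2 ^ (n + g * (2 * G + 1))) ^ 2)).
  rewrite mul2n -addnn leq_add // leq_exp2r // (leq_trans _ le_Q) //.
    by lia.
  by lia.
by rewrite -expnM -expnS leq_pexp2l //; lia.
Qed.

(** * Assembling the monomials *)

Local Open Scope ring_scope.

(** The exponentials are written [(g ^ x_i) ^ b_i], so that for numerals [b_i] the
    result is a polynomial in the [x_i] and the [g ^ x_i]. *)
Lemma mvalue4 (t : nat) (g : nat) (alpha : int)
    (b1 b2 b3 b4 c1 c2 c3 c4 : nat) (x : {ffun 'I_4 -> 'I_t}) :
  let x1 := x (@Ordinal 4 0 isT) : nat in let x2 := x (@Ordinal 4 1 isT) : nat in
  let x3 := x (@Ordinal 4 2 isT) : nat in let x4 := x (@Ordinal 4 3 isT) : nat in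
  mvalue (Monomial alpha [tuple g; g; g; g]
            [tuple b1; b2; b3; b4] [tuple c1; c2; c3; c4]) x
  = alpha%:~R *
    ((g%:R ^+ x1) ^+ b1 * (g%:R ^+ x2) ^+ b2 *
     (g%:R ^+ x3) ^+ b3 * (g%:R ^+ x4) ^+ b4 *
     (x1%:R ^+ c1 * x2%:R ^+ c2 * x3%:R ^+ c3 * x4%:R ^+ c4)).
Proof.
have lift4 j (lt_j : (j < 4)%N) i : val i = j -> i = Ordinal lt_j.
  by move=> eq_i; apply: val_inj.
move=> x1 x2 x3 x4; rewrite /mvalue !big_ord_recl big_ord0 !(tnth_nth 0%N) /= mulr1.
rewrite (lift4 3%N isT (lift ord0 (lift ord0 (lift ord0 ord0)))) //.
rewrite (lift4 2%N isT (lift ord0 (lift ord0 ord0))) //.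
rewrite (lift4 1%N isT (lift ord0 ord0)) // (lift4 0%N isT ord0) //.
by rewrite -/x1 -/x2 -/x3 -/x4 ![(_ * nat_of_ord _)%N]mulnC !exprM; ring.
Qed.

Lemma defect_ratE (m g n x1 x2 x3 x4 : nat) :
  (defect m g n x1 x2 x3 x4)%:R =
  (g%:R ^+ (x1 + x2 + 1) - (m%:R + n%:R * x4%:R)) ^+ 2
  + (x1%:R + x2%:R + x3%:R + 1 - (totient n)%:R) ^+ 2 :> rat.
Proof.
rewrite /defect natrD !natrX !natr_absz !intr_norm !real_normK ?num_real //.
by rewrite !rmorphB /= -!pmulrn !(natrD, natrM) natrX.
Qed.

(** The identity holds point by point: there it says that the fourteen monomials
    and the constant term sum to [box_defect]. *)
Lemma dlog_M_box (m g n : nat) :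
  let t := dlog_t g n in let w := dlog_w g n in
  dlog_M m g n =
  \sum_(x : {ffun 'I_4 -> 'I_t})
    2 ^+ (2 * w * undigits x)
    * ((2 ^+ w - 1) * (2 ^+ w + 1 - (box_defect m g n x)%:R)).
Proof.
move=> t w; have t_gt0: (0 < t)%N by rewrite /t /dlog_t addn1.
rewrite /dlog_M -/t -/w /= Cterm_box !Aterm_box // -!sumrN -!big_split /=.
apply: eq_bigr => x _; rewrite !mvalue4 /box_defect defect_ratE.
rewrite -!mulrN -!mulrDr; congr (_ * (_ * _)).
set x1 := nat_of_ord (x _); set x2 := nat_of_ord (x _).
set x3 := nat_of_ord (x _); set x4 := nat_of_ord (x _).
move: (2 ^+ w) => W; rewrite !exprD; ring.
Qed.

Theorem theorem11p3 (m g n : nat) :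
  (3 <= n)%N -> (2 <= m <= n.-1)%N -> (2 <= g)%N ->
  coprime n m -> is_primitive_root n g ->
  exists2 N : nat, dlog_M m g n = N%:R :> rat
    & (dlog m g n)%:R =
      (HW N)%:R / (5 + 2 * n + 2 * g * (2 * g ^ totient n + 1))%N%:R
      - ((g ^ totient n + 1) ^ 4)%N%:R :> rat.
Proof.
move=> n_ge3 /andP[_ le_mn] g_ge2 _ prim_g.
set t := dlog_t g n; set w := dlog_w g n.
have le_box (x : {ffun 'I_4 -> 'I_t}) : (box_defect m g n x <= 2 ^ w)%N.
  have le_G i : (x i <= g ^ totient n)%N.
    by rewrite -ltnS -[X in (_ < X)%N]addn1 ltn_ord.
  by apply: defect_leq => //; lia.
exists (\sum_(x : {ffun 'I_4 -> 'I_t}) 2 ^ (2 * w * undigits x)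
        * ((2 ^ w - 1) * (2 ^ w + 1 - box_defect m g n x)))%N.
  rewrite dlog_M_box natr_sum; apply: eq_bigr => x _.
  have le_box1 := leq_trans (le_box x) (leq_addr 1 _).
  by rewrite !natrM !natrX !natrB ?expn_gt0 // natrD natrX.
rewrite HW_box // card_defect0 //; [|by lia|by rewrite /t /dlog_t addn1].
have w_neq0: w%:R != 0 :> rat by rewrite pnatr_eq0 /w /dlog_w.
rewrite -/(dlog_w g n) -/w -/(dlog_t g n) -/t natrM mulrAC divff // mul1r.
by rewrite natrD addrAC subrr add0r.
Qed.
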